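(* Let $Y$ be a finite graph with an edge-free action of a finite group $G$, and let $\mathbb{X}=Y/\!\!/G$ be the quotient graph of groups. Then the zeta function $\zeta(u,\mathbb{X})$ divides the zeta function $\zeta(u,Y)$, i.e. the polynomial $\zeta(u,\mathbb{X})^{-1}$ divides the polynomial $\zeta(u,Y)^{-1}$.
   Context: Graphs. A graph (with legs) $X$ consists of vertices $V(X)$, half-edges $H(X)$, a root map $r:H(X)\to V(X)$, and an involution $h\mapsto\overline h$ on $H(X)$. Orbits $\{h,\overline h\}$ of size 2 are edges; half-edges with $\overline h=h$ are legs. All graphs are connected. A path of length $n\ge1$ in $X$ is a sequence $h_1\cdots h_n$ of half-edges with $r(h_{j+1})=r(\overline{h_j})$ for $1\le j\le n-1$; it is closed if $r(\overline{h_n})=r(h_1)$; a closed path is reduced if $h_{j+1}\ne\overline{h_j}$ for all $j\in\{1,\dots,n\}$ (indices mod $n$). A closed reduced path is primitive if it is not a power $R^k$, $k\ge2$, of a path. Closed paths are equivalent if they differ by a cyclic shift. A prime $\mathfrak p$ is an equivalence class of primitive paths, with length $\ell(\mathfrak p)$ the common length of its representatives. The Ihara zeta function of a finite graph $Y$ is $\zeta(u,Y)=\prod_{\mathfrak p}(1-u^{\ell(\mathfrak p)})^{-1}$ over all primes of $Y$. Graphs of groups. An edge-trivial graph of groups $\mathbb{X}=(X,X_v)$ is a graph $X$ with a group $X_v$ for each $v\in V(X)$. A path of length $n\ge1$ in $\mathbb{X}$ is $g_0h_1g_1h_2\cdots g_{n-1}h_n$ where $h_1\cdots h_n$ is a path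 in $X$, $g_0\in X_{r(h_1)}$ and $g_j\in X_{r(\overline{h_j})}$ for $1\le j\le n-1$. It is closed if $h_1\cdots h_n$ is closed; a closed path is reduced if for each $j\in\{1,\dots,n\}$ (indices mod $n$) either $h_{j+1}\ne\overline{h_j}$ or $g_j\ne1$. Primitive paths, equivalence (simultaneous cyclic shift of the $g_{j-1}$ and $h_j$), primes and lengths are defined as for graphs. When $X$ and all $X_v$ are finite, $\zeta(u,\mathbb{X})=\prod_{\mathfrak q}(1-u^{\ell(\mathfrak q)})^{-1}$ over all primes of $\mathbb{X}$. Both zeta functions converge for small complex $u$ and are reciprocals of polynomials in $u$; divisibility of zeta functions refers to divisibility of these reciprocal polynomials. Quotients. A $G$-action on $Y$ (by bijections of $V(Y)$ and $H(Y)$ commuting with $r$ and the involution) is edge-free if $G$ acts freely on $H(Y)$. The quotient graph $X=Y/G$ has $V(X)=V(Y)/G$, $H(X)=H(Y)/G$, with induced root map and involution. Choose a spanning tree $T_X\subset X$ and a connected lift $T\subset Y$ of it; for $v\in V(X)$ let $v^T$ be its lift to $T$. The graph of groups $\mathbb{X}=Y/\!\!/G$ has underlying graph $X$ and $X_v=$ stabilizer of $v^T$ in $G$. *)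

(* Defs.v *)
Set Warnings "-notation-overridden,-ambiguous-paths,-notation-incompatible-prefix".
From HB Require Import structures.
From mathcomp Require Import all_boot all_order all_algebra all_fingroup.
From mathcomp Require Import complex.
From mathcomp Require Import all_classical all_reals all_analysis.
Import Order.TTheory GRing.Theory Num.Theory.
Import numFieldNormedType.Exports.

Set Implicit Arguments.
Unset Strict Implicit.
Unset Printing Implicit Defensive.

Local Open Scope ring_scope.

(** * Finite graphs with legs *)

(* The edges are the orbits of [bar] of size 2, the legs its fixed points. *)
Record graph := Graph {
  vertex : finType;
  half_edge : finType;
  rootv : half_edge -> vertex;
  bar : half_edge -> half_edge;
  barK : involutive bar
}.

Definition adjacent_in (X : graph) (T : {set half_edge X}) : rel (vertex X) :=
  fun v w => [exists h in T, (rootv h == v) && (rootv (bar h) == w)].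

Definition connected_by (X : graph) (T : {set half_edge X}) : Prop :=
  forall v w : vertex X, connect (adjacent_in T) v w.

Definition connected_graph (X : graph) : Prop :=
  (0 < #|vertex X|)%N /\ connected_by [set: half_edge X].

(** * Graphs of groups with trivial edge groups *)

Record graph_of_groups := GraphOfGroups {
  base : graph;
  vgroup : vertex base -> finGroupType
}.

(** * Paths and primes *)

(* Common frame for paths in graphs and in graphs of groups: a path is a
   nonempty word in [letter]; [follows a b] says that the letter [b] may come
   directly after [a] in a path, and [reducible a b] that "a then b" is a
   backtracking. *)
Record path_system := PathSystem {
  letter : finType;
  follows : rel letter;
  reducible : rel letter
}.

(* A path h_1 ... h_n is read as the word of its half-edges. *)
Definition graph_paths (X : graph) : path_system :=
  @PathSystem (half_edge X)
    (fun h h' => rootv h' == rootv (bar h))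
    (fun h h' => h' == bar h).

(* A path g_0 h_1 g_1 h_2 ... g_{n-1} h_n is read as the word whose j-th letter
   is the pair (h_j, g_{j-1}). Since r(h_{j+1}) = r(bar h_j) along a path, g_j
   lies in the vertex group at r(h_{j+1}), the root of its own letter. *)
Definition gog_paths (X : graph_of_groups) : path_system :=
  @PathSystem {h : half_edge (base X) & vgroup (rootv h)}
    (fun s t => rootv (tag t) == rootv (bar (tag s)))
    (fun s t => (tag t == bar (tag s)) && (tagged t == 1%g)).

Section Primes.
Variable S : path_system.
Implicit Type p : seq (letter S).

Definition is_path p : bool := (p != [::]) && sorted (@follows S) p.

(* [path.cycle e [:: a_1; ...; a_n]] requires e a_j a_{j+1} for all j mod n. *)
Definition closed_path p : bool := is_path p && path.cycle (@follows S) p.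

Definition closed_reduced p : bool :=
  closed_path p && path.cycle (fun a b => ~~ reducible a b) p.

Definition path_power p (k : nat) : seq (letter S) := flatten (nseq k p).

Definition primitive p : Prop :=
  closed_reduced p /\
  ~ (exists r k, [/\ is_path r, (2 <= k)%N & p = path_power r k]).

(* The primes of length n are the classes, under cyclic shift, of the primitive
   paths of length n. *)
Definition shift_class (n : nat) (p : n.-tuple (letter S)) :
    {set n.-tuple (letter S)} :=
  [set q : n.-tuple (letter S) | `[< exists k, tval q = rot k p >]].

Definition primes_of_length (n : nat) : {set {set n.-tuple (letter S)}} :=
  [set shift_class p | p : n.-tuple (letter S) & `[< primitive p >]].

End Primes.

(** * Zeta functions *)

(* The complex numbers, as a type that carries its norm topology. *)
Definition Cplx (R : realType) : numClosedFieldType := R[i].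

Section Zeta.
Variables (R : realType) (S : path_system).
Local Notation C := (Cplx R).

(* Partial Euler product, over the primes of length at most N. *)
Definition euler_product (u : C) (N : nat) : C :=
  \prod_(1 <= n < N.+1) \prod_(p in primes_of_length S n) (1 - u ^+ n)^-1.

Definition zeta (u : C) : C := limn (euler_product u).

Definition zeta_reciprocal (P : {poly C}) : Prop :=
  \forall u \near (0 : C),
    [/\ cvgn (euler_product u), P.[u] != 0 & zeta u = P.[u]^-1].

Lemma zeta_reciprocal_unique (P Q : {poly C}) :
  zeta_reciprocal P -> zeta_reciprocal Q -> P = Q.
Proof.
move=> hP hQ.
have : \forall u \near (0 : C), P.[u] = Q.[u].
  near=> u; apply: invr_inj.
  have [_ _ <-] : [/\ cvgn (euler_product u), P.[u] != 0 & zeta u = P.[u]^-1].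
    by near: u.
  by have [_ _ <-] :
    [/\ cvgn (euler_product u), Q.[u] != 0 & zeta u = Q.[u]^-1] by near: u.
move=> /nbhs_ballP[e /= e0 he].
apply/eqP; rewrite -subr_eq0; apply/negPn/negP => nz.
pose x (k : nat) : C := e / k.+2%:R.
have ux : uniq (map x (iota 0 (size (P - Q)))).
  rewrite map_inj_uniq ?iota_uniq // => j k /(mulfI (lt0r_neq0 e0)) /invr_inj.
  by move=> /eqP; rewrite eqr_nat => /eqP [].
have rx : all (root (P - Q)) (map x (iota 0 (size (P - Q)))).
  apply/allP => _ /mapP[k _ ->]; rewrite rootE !hornerE subr_eq0; apply/eqP/he.
  rewrite -ball_normE /= sub0r normrN normrM normfV (gtr0_norm e0) normr_nat.
  by rewrite ltr_pdivrMr ?ltr0n // ltr_pMr // ltr1n.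
by have := max_poly_roots nz rx ux; rewrite size_map size_iota ltnn.
Unshelve. all: by end_near.
Qed.

End Zeta.

(** * Group actions and quotients *)

Record graph_action (gT : finGroupType) (Y : graph) := GraphAction {
  actV : {action gT &-> vertex Y};
  actH : {action gT &-> half_edge Y};
  act_rootv : forall h a, rootv (actH h a) = actV (rootv h) a;
  act_bar : forall h a, bar (actH h a) = actH (bar h) a
}.

Definition edge_free (gT : finGroupType) (Y : graph) (A : graph_action gT Y) :
    Prop :=
  forall h a, actH A h a = h -> a = 1%g.

Section Orbits.
Variable gT : finGroupType.

Definition orbits (T : finType) (to : {action gT &-> T}) : {set {set T}} :=
  [set orbit to [set: gT] x | x : T].

Definition quotient_type (T : finType) (to : {action gT &-> T}) : finType :=
  {O : {set T} | O \in orbits to}.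

Definition orbit_proj (T : finType) (to : {action gT &-> T}) (x : T) :
    quotient_type to :=
  exist _ (orbit to [set: gT] x) (imset_f _ isT).

Variables (T T' : finType) (to : {action gT &-> T}) (to' : {action gT &-> T'}).
Variables (f : T -> T') (fE : forall x a, f (to x a) = to' (f x) a).

Lemma imset_orbit x :
  [set f y | y in orbit to [set: gT] x] = orbit to' [set: gT] (f x).
Proof.
apply/setP => z; apply/imsetP/orbitP => [[_ /orbitP[a _ <-] ->]|[a _ <-]].
  by exists a; rewrite ?inE // fE.
by exists (to x a); rewrite ?fE //; apply/orbitP; exists a; rewrite ?inE.
Qed.

Lemma imset_orbits (O : {set T}) : O \in orbits to -> f @: O \in orbits to'.
Proof. by case/imsetP => x _ ->; rewrite imset_orbit imset_f. Qed.

Definition quotient_map (O : quotient_type to) : quotient_type to' :=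
  exist _ (f @: sval O) (imset_orbits (svalP O)).

Lemma quotient_mapE x : quotient_map (orbit_proj to x) = orbit_proj to' (f x).
Proof. by apply: val_inj; rewrite /= imset_orbit. Qed.

End Orbits.

Section Quotient.
Variables (gT : finGroupType) (Y : graph) (A : graph_action gT Y).

Lemma quotient_barK : involutive (quotient_map (@act_bar _ _ A)).
Proof.
move=> O; apply: val_inj => /=.
by rewrite -imset_comp (eq_imset _ (@barK Y)) imset_id.
Qed.

Definition quotient_graph : graph :=
  @Graph (quotient_type (actV A)) (quotient_type (actH A))
    (quotient_map (@act_rootv _ _ A)) (quotient_map (@act_bar _ _ A))
    quotient_barK.

End Quotient.

(* A spanning tree, given by its set of half-edges: a set of edges (and no
   legs) that connects all vertices and carries no closed reduced path. *)
Definition spanning_tree (X : graph) (T : {set half_edge X}) : Prop :=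
  [/\ forall h, h \in T -> bar h \in T /\ bar h != h,
      connected_by T
    & forall p : seq (half_edge X),
        {subset p <= T} -> ~~ @closed_reduced (graph_paths X) p].

(* A lift to Y of the subgraph of Y/G with all vertices and half-edges TX: a
   graph morphism defined on it that is a section of Y -> Y/G. When TX is a
   spanning tree, the connected lifts of TX are the images of these sections.
   The value of [liftH] outside TX is irrelevant. *)
Record tree_lift (gT : finGroupType) (Y : graph) (A : graph_action gT Y)
    (TX : {set half_edge (quotient_graph A)}) := TreeLift {
  liftV : vertex (quotient_graph A) -> vertex Y;
  liftH : half_edge (quotient_graph A) -> half_edge Y;
  liftV_proj : forall v, orbit_proj (actV A) (liftV v) = v;
  liftH_proj : forall h, h \in TX -> orbit_proj (actH A) (liftH h) = h;
  lift_rootv : forall h, h \in TX -> rootv (liftH h) = liftV (rootv h);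
  lift_bar : forall h, h \in TX -> bar (liftH h) = liftH (bar h)
}.

(* The vertex group at v is the stabilizer of the lift of v. *)
Definition quotient_gog (gT : finGroupType) (Y : graph) (A : graph_action gT Y)
    (TX : {set half_edge (quotient_graph A)}) (T : tree_lift TX) :
    graph_of_groups :=
  @GraphOfGroups (quotient_graph A)
    (fun v => subg_of ('C[liftV T v | actV A])%G).

(* Main.v *)
Require Import Defs.
From mathcomp Require Import all_boot all_order all_algebra all_fingroup.
From mathcomp Require Import complex ring.
From mathcomp Require Import all_classical all_reals all_analysis.
Import Order.TTheory GRing.Theory Num.Theory.
Import numFieldNormedType.Exports.

(** Both zeta functions are of the form [1 / det (1 - u W)], where [W] is the
    0/1 matrix, indexed by the letters, of the reduced steps: the Euler product
    and the determinant have the same logarithmic derivative, because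
    [tr (W ^ m) = sum_(d | m) d * #(primes of length d)] counts the closed
    reduced paths of length [m].

    For the quotient graph of groups, the steps out of [(h, g)] do not depend on
    [g], so [W] factors through the functions on the half-edges of [Y / G] and
    [det (1 - u W) = det (1 - u B)] for a matrix [B] indexed by these. Since the
    action is edge-free, the lifts of a half-edge at a given vertex of [Y] form
    a torsor under the stabilizer of the vertex, hence [B] is the restriction of
    the matrix of [Y] to the [G]-invariant functions, and [det (1 - u B)]
    divides the determinant for [Y]. *)

Set Implicit Arguments.
Unset Strict Implicit.
Unset Printing Implicit Defensive.

(** * Primes and periods of cyclic words *)

Section Words.
Variable T : eqType.
Implicit Types (r s t : seq T) (e : rel T).

(** Comparing the first [size s] letters of [s ++ t] and [t ++ s] shows that [t] starts with [s];
    the rest of [t] still commutes with [s]. *)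
Lemma cat_comm_power s t j :
  size t = (j * size s)%N -> s ++ t = t ++ s -> t = flatten (nseq j s).
Proof.
elim: j t => [|j IHj] t; first by move/size0nil.
rewrite mulSn => szt st.
have ts : take (size s) t = s.
  have := congr1 (take (size s)) st.
  by rewrite take_size_cat // takel_cat // szt leq_addr.
have := cat_take_drop (size s) t; rewrite ts => te.
have szu : size (drop (size s) t) = (j * size s)%N.
  by rewrite size_drop szt addKn.
move: (drop _ _) te szu => u te szu.
rewrite -te /=; congr (_ ++ _); apply: IHj => //.
by move: st; rewrite -te -catA => /eqP; rewrite eqseq_cat // eqxx => /eqP.
Qed.

(** Being fixed by [rot d] means that the prefix of length [d] commutes with the remaining
    suffix. *)
Lemma rot_fix_power d k s : size s = (k * d)%N -> rot d s = s ->
  s = flatten (nseq k (take d s)).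
Proof.
case: k => [|k] szs rs; first exact: size0nil.
have szt : size (take d s) = d by rewrite size_takel // szs mulSn leq_addr.
rewrite -{1}(cat_take_drop d s) /=; congr (_ ++ _); apply: cat_comm_power.
  by rewrite szt size_drop szs mulSn addKn.
by rewrite cat_take_drop; exact: esym rs.
Qed.

Lemma rot_size_power k s :
  rot (size s) (flatten (nseq k s)) = flatten (nseq k s).
Proof.
case: k => // k; rewrite /= rot_size_cat.
by elim: k => [|k IHk] /=; rewrite ?cats0 // -catA IHk.
Qed.

Lemma rot1_power k s :
  rot 1 (flatten (nseq k s)) = flatten (nseq k (rot 1 s)).
Proof.
case: s => [|x s]; first by elim: k => //= k ->.
case: k => // k; rewrite rot1_cons /= rot1_cons.
elim: k => [|k IHk] /=; first by rewrite !cats0.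
by rewrite -IHk cat_rcons rcons_cat.
Qed.

Lemma cycle_power e k s : (0 < k)%N ->
  path.cycle e (flatten (nseq k s)) = path.cycle e s.
Proof.
case: k => // k _.
case: s => [|x s]; first by elim: k => [|k] //= ->.
rewrite /=; elim: k => [|k IHk] /=; first by rewrite cats0.
by rewrite rcons_cat /= -cat_rcons cat_path last_rcons IHk andbb.
Qed.

End Words.

Lemma dvdn_fingraph_order (T : finType) (f : T -> T) x k : injective f ->
  iter k f x = x -> (fingraph.order f x %| k)%N.
Proof.
move=> fI fk; have o0 := fingraph.order_gt0 f x.
have fm m : iter (m * fingraph.order f x) f x = x.
  by elim: m => // m IHm; rewrite mulSn iterD IHm iter_order.
move: fk; rewrite {1}(divn_eq k (fingraph.order f x)) addnC iterD fm => fk.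
by have := findex_iter (ltn_pmod k o0); rewrite fk findex0 => /esym /eqP.
Qed.

(** * Rotations of tuples, and closed words sorted by period *)

Section Rotation.
Variables (T : finType) (e : rel T).

Definition trot n (t : n.-tuple T) : n.-tuple T := [tuple of rot 1 t].

Lemma trot_inj n : injective (@trot n).
Proof.
by move=> s t /(congr1 val) /= /eqP; rewrite eqseq_rot => /eqP /val_inj.
Qed.

Lemma iter_trot n (t : n.-tuple T) k :
  (k <= n)%N -> tval (iter k (@trot n) t) = rot k t.
Proof.
elim: k => [|k IHk] kn; first by rewrite rot0.
by rewrite /= IHk ?(ltnW kn) // [RHS]rotS // size_tuple.
Qed.

Definition period n (t : n.-tuple T) := fingraph.order (@trot n) t.

Lemma period_dvd n (t : n.-tuple T) : (period t %| n)%N.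
Proof.
apply: dvdn_fingraph_order; first exact: trot_inj.
by apply: val_inj; rewrite [LHS]iter_trot //= rot_oversize // size_tuple.
Qed.

Lemma rot_period n (t : n.-tuple T) : (0 < n)%N -> rot (period t) t = t.
Proof.
move=> n0; rewrite -iter_trot ?(dvdn_leq n0) ?period_dvd //.
by rewrite /period iter_order //; exact: trot_inj.
Qed.

Lemma period_rot n (t : n.-tuple T) : period (trot t) = period t.
Proof.
exact: (orbitPcycle 0 1).1 (cycle_orbit (@trot_inj n) t).
Qed.

Definition prime_words n :=
  [set t : n.-tuple T | path.cycle e t && (period t == n)].

Fact power_tupleP n k (t : n.-tuple T) :
  size (flatten (nseq k (tval t))) == (k * n)%N.
Proof. by rewrite size_flatten /shape map_nseq sumn_nseq size_tuple mulnC. Qed.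
Definition power_tuple n k (t : n.-tuple T) : (k * n).-tuple T :=
  Tuple (power_tupleP k t).

Lemma power_tuple_inj n k : (0 < k)%N -> injective (@power_tuple n k).
Proof.
case: k => // k _ s t /(congr1 val) /= /eqP.
by rewrite eqseq_cat ?size_tuple // => /andP[/eqP/val_inj].
Qed.

(** Taking [k]-th powers is injective and commutes with the rotation by one letter, so each period
    divides the other. *)
Lemma period_power n k (t : n.-tuple T) : (0 < k)%N ->
  period (power_tuple k t) = period t.
Proof.
move=> k0; have tr (s : n.-tuple T) :
    power_tuple k (trot s) = trot (power_tuple k s).
  by apply: val_inj; rewrite /= rot1_power.
have itr m s : iter m (@trot _) (power_tuple k s)
    = power_tuple k (iter m (@trot n) s).
  by elim: m => //= m ->; rewrite tr.
apply/eqP; rewrite eqn_dvd; apply/andP; split; apply: dvdn_fingraph_order.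
- exact: trot_inj.
- by rewrite itr iter_order //; exact: trot_inj.
- exact: trot_inj.
- apply: (power_tuple_inj k0); rewrite -itr.
  by rewrite /period iter_order //; exact: trot_inj.
Qed.

(** A word of length [m] and period [d] is the [m / d]-th power of its prefix of length [d], and
    taking powers preserves period and closedness. *)
Lemma card_cycle_period m d : (0 < m)%N -> (d %| m)%N ->
  #|[set t : m.-tuple T | path.cycle e t && (period t == d)]|
    = #|prime_words d|.
Proof.
move=> + /dvdnP[k mE]; rewrite {}mE => m0.
have := m0; rewrite muln_gt0 => /andP[k0 d0].
rewrite -[RHS](card_imset _ (@power_tuple_inj d k k0)); apply: eq_card => t.
rewrite inE; apply/andP/imsetP => [[ct /eqP pt]|[s]]; last first.
  rewrite inE => /andP[cs ps] ->; split; last by rewrite period_power.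
  by rewrite cycle_power.
have rt : rot d t = t by have := rot_period t m0; rewrite pt.
have szd : size (take d t) == d.
  by rewrite size_takel // size_tuple leq_pmull.
have tE : t = power_tuple k (Tuple szd).
  by apply: val_inj => /=; apply: rot_fix_power => //; rewrite size_tuple.
exists (Tuple szd) => //; rewrite inE -(period_power _ k0) -tE pt eqxx andbT.
by move: ct; rewrite {1}tE cycle_power.
Qed.

(** The words are sorted by their period, a divisor of [m]. The bound [N] gives the sums for all [m]
    a common range, as the truncated Euler product requires. *)
Lemma card_cycle_words m N : (0 < m <= N)%N ->
  #|[set t : m.-tuple T | path.cycle e t]|
    = \sum_(1 <= d < N.+1 | d %| m) #|prime_words d|.
Proof.
case/andP=> m0 mN.
transitivity (\sum_(t : m.-tuple T | path.cycle e t)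
    \sum_(1 <= d < N.+1 | d %| m) (period t == d)).
  rewrite -sum1dep_card; apply: eq_bigr => t _.
  have pm : (period t <= m)%N by rewrite dvdn_leq ?period_dvd.
  rewrite big_mkcond (bigD1_seq (period t)) ?iota_uniq //=; last first.
    rewrite mem_index_iota ltnS (leq_trans pm mN) andbT.
    by rewrite (dvdn_gt0 m0) ?period_dvd.
  rewrite period_dvd eqxx big1 // => d /negPf.
  by rewrite eq_sym => ->; rewrite if_same.
rewrite exchange_big /=; apply: eq_bigr => d dm.
rewrite -(card_cycle_period m0 dm) -sum1dep_card big_mkcondr /=.
by apply: eq_bigr => t _; case: eqP.
Qed.

End Rotation.

(** * Primes as rotation orbits of full period *)

Section CountPrimes.
Variable S : path_system.
Notation L := (letter S).

Definition step : rel L := [rel a b | follows a b && ~~ reducible a b].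

Lemma closed_reducedE (p : seq L) :
  closed_reduced p = (p != [::]) && path.cycle step p.
Proof.
case: p => // a p; rewrite /closed_reduced /closed_path /is_path /=.
have -> : forall q x, path step x q
    = path (@follows S) x q && path (fun y z => ~~ reducible y z) x q.
  by elim=> //= b q IHq x; rewrite IHq andbACA.
by rewrite rcons_path; case: path.
Qed.

(** A period smaller than [n] makes [t] a proper power of its prefix of that length. Conversely a
    power of [r] is fixed by [rot (size r)], so its period is at most [size r]. *)
Lemma primitiveP n (t : n.-tuple L) : (0 < n)%N ->
  primitive t <-> t \in prime_words step n.
Proof.
move=> n0; have tn0 : tval t != [::] by rewrite -size_eq0 size_tuple -lt0n.
rewrite /primitive closed_reducedE tn0 inE /=; split.
  move=> [ct np]; rewrite ct; apply/negPn/negP => pn; apply: np.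
  have /dvdnP[k nE] := period_dvd t.
  have tE := rot_fix_power (etrans (size_tuple t) nE) (rot_period t n0).
  have k2 : (2 <= k)%N.
    case: k nE {tE} => [|[|k]] // nE; first by move: n0; rewrite nE.
    by move: pn; rewrite [X in _ == X]nE mul1n eqxx.
  exists (take (period t) t), k; split => //.
  rewrite /is_path -size_eq0 size_takel; last first.
    by rewrite size_tuple dvdn_leq ?period_dvd.
  rewrite -lt0n fingraph.order_gt0 /=; apply: take_sorted.
  have : closed_reduced t by rewrite closed_reducedE tn0.
  by rewrite /closed_reduced /closed_path /is_path => /andP[/andP[/andP[]]].
case/andP=> ct /eqP pt; split => // -[r [k [rp k2 tE]]].
have r0 : (0 < size r)%N by rewrite lt0n size_eq0; case/andP: rp.
have nE : n = (k * size r)%N.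
  rewrite -[LHS](size_tuple t) tE size_flatten /shape map_nseq sumn_nseq.
  by rewrite mulnC.
have : (period t %| size r)%N.
  apply: dvdn_fingraph_order; first exact: trot_inj.
  apply: val_inj; rewrite /= iter_trot ?nE ?leq_pmull ?(ltnW k2) //= tE.
  by rewrite rot_size_power.
move/(dvdn_leq r0); rewrite pt nE -{2}[size r]mul1n leq_pmul2r //.
by rewrite leqNgt k2.
Qed.

Lemma mem_shift_class n (t u : n.-tuple L) :
  (u \in shift_class t) = fconnect (@trot L n) t u.
Proof.
rewrite inE; apply/asboolP/idP => [[k uE]|/iter_findex <-].
  (* [rot k] is the identity for [k] beyond the length, rather than the rotation by [k] mod [n];
     hence this case, and the one where [n <= j] below. *)
  have [kn|nk] := leqP k n; last first.
    rewrite (_ : u = t) //; apply: val_inj.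
    by rewrite [LHS]uE rot_oversize // size_tuple ltnW.
  rewrite (_ : u = iter k (@trot L n) t) ?fconnect_iter //.
  by apply: val_inj; rewrite [LHS]uE [RHS]iter_trot.
elim: (findex _ _ _) => [|k [j IHk]]; first by exists 0%N; rewrite rot0.
rewrite /= IHk; have [jn|nj] := ltnP j n.
  by exists j.+1; rewrite [RHS]rotS // size_tuple.
by exists 1%N; rewrite (rot_oversize (n := j)) // size_tuple.
Qed.

Lemma prime_words_closed n (t u : n.-tuple L) :
  fconnect (@trot L n) t u ->
  (u \in prime_words step n) = (t \in prime_words step n).
Proof.
move/iter_findex <-; elim: (findex _ _ _) => //= k IHk.
by rewrite -IHk !inE period_rot rot_cycle.
Qed.

(** The shift classes are the orbits of the rotation, and an orbit of words of period [n] has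
    exactly [n] elements. *)
Lemma card_prime_words n : (0 < n)%N ->
  #|prime_words step n| = (n * #|primes_of_length S n|)%N.
Proof.
move=> n0.
have pE : primes_of_length S n = [set shift_class t | t in prime_words step n].
  apply/setP => P; apply/imsetP/imsetP => -[t tP ->]; exists t => //.
    by apply/(primitiveP t n0); move: tP; rewrite inE => /asboolP.
  by rewrite inE; apply/asboolP/(primitiveP t n0).
rewrite pE -sum1_card (partition_big_imset (@shift_class S n)) /= mulnC.
rewrite -sum_nat_const; apply: eq_bigr => _ /imsetP[t tP ->].
have pt : period t = n by move: tP; rewrite inE => /andP[_ /eqP].
rewrite sum1dep_card -[RHS]pt; apply: eq_card => u; rewrite inE.
rewrite -[RHS]/(fconnect _ t u); apply/andP/idP => [[_ /eqP tu]|tu].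
  by rewrite -mem_shift_class -tu mem_shift_class.
split; first by rewrite (prime_words_closed tu).
apply/eqP/setP => v; rewrite !mem_shift_class.
by apply/esym; apply: same_connect => //; apply: fconnect_sym; exact: trot_inj.
Qed.

End CountPrimes.

Local Open Scope ring_scope.

(** * Logarithmic derivatives of polynomials *)

Lemma deriv_prod_seq (R : comNzRingType) (I : eqType) (r : seq I)
    (f : I -> {poly R}) : uniq r ->
  (\prod_(i <- r) f i)^`()
    = \sum_(i <- r) (f i)^`() * \prod_(j <- r | j != i) f j.
Proof.
elim: r => [|x r IHr] /=; first by rewrite !big_nil derivC.
case/andP=> xr ur; rewrite !big_cons derivM eqxx IHr //=; congr (_ * _ + _).
  rewrite [RHS]big_seq_cond [LHS]big_seq; apply: eq_bigl => j.
  by case: eqVneq => [->|]; rewrite ?(negPf xr) ?andbT.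
rewrite mulr_sumr [LHS]big_seq [RHS]big_seq; apply: eq_bigr => i ir.
rewrite big_cons ifT ?(mulrCA (f x)) //.
by apply: contraNneq xr => ->.
Qed.

(** Jacobi's formula. By the product rule in the Leibniz expansion, the derivative is the sum of the
    determinants of the [B i], in which row [i] alone is differentiated. *)
Lemma deriv_det (R : comNzRingType) n (A : 'M[{poly R}]_n) :
  (\det A)^`() = \tr (map_mx (@deriv R) A *m \adj A).
Proof.
pose B i := \matrix_(k, j) (if k == i then (A k j)^`() else A k j).
transitivity (\sum_i \det (B i)).
  rewrite exchange_big /= raddf_sum; apply: eq_bigr => s _.
  rewrite -mulr_sumr -!(rmorph_sign (@polyC R)).
  rewrite mul_polyC /= derivZ -mul_polyC deriv_prod_seq ?index_enum_uniq //.
  congr (_ * _); apply: eq_bigr => i _.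
  rewrite [RHS](bigD1 i) //= mxE eqxx; congr (_ * _).
  by apply: eq_bigr => j /negPf ji; rewrite mxE ji.
(* The cofactors along row [i] omit that row, so they are the same for [B i] and [A]. *)
apply: eq_bigr => i _; rewrite (expand_det_row _ i) mxE; apply: eq_bigr => j _.
rewrite !mxE eqxx /cofactor; congr (_ * (_ * \det _)).
by apply/matrixP => k l; rewrite !mxE eq_sym (negPf (neq_lift _ _)).
Qed.

(* When [f] has constant term 1, this says that [X f' / f = - g] mod [X ^ M]. *)
Definition logder_mod (F : fieldType) M (f g : {poly F}) :=
  'X^M %| 'X * f^`() + f * g.

Section LogDer.
Variable F : fieldType.
Implicit Types f g : {poly F}.

Lemma dvdXnP M f : reflect (forall k, (k < M)%N -> f`_k = 0) ('X^M %| f).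
Proof.
apply: (iffP idP) => [/dvdpP[q ->] k kM|f0]; first by rewrite coefMXn kM.
rewrite -[f](poly_take_drop M) (_ : take_poly M f = 0) ?add0r ?dvdp_mull //.
by apply/polyP => k; rewrite coef_take_poly coef0; case: ifP => // /f0.
Qed.

Lemma logder_mod1 M : logder_mod M (1 : {poly F}) 0.
Proof. by rewrite /logder_mod derivC !mulr0 addr0. Qed.

Lemma logder_modM M f1 f2 g1 g2 :
  logder_mod M f1 g1 -> logder_mod M f2 g2 -> logder_mod M (f1 * f2) (g1 + g2).
Proof.
rewrite /logder_mod => h1 h2.
have -> : 'X * (f1 * f2)^`() + f1 * f2 * (g1 + g2)
  = ('X * f1^`() + f1 * g1) * f2 + f1 * ('X * f2^`() + f2 * g2).
  by rewrite derivM; ring.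
by apply: dvdp_add; [exact: dvdp_mulr|exact: dvdp_mull].
Qed.

Lemma logder_modX M f g n :
  logder_mod M f g -> logder_mod M (f ^+ n) (g *+ n).
Proof.
move=> h; elim: n => [|n IHn]; first by rewrite mulr0n expr0 logder_mod1.
by rewrite exprS mulrS logder_modM.
Qed.

End LogDer.

(** The condition is linear in [f], so it holds for the difference [h]. As [g] has no constant term,
    coefficient [k] expresses [k h_k] through the earlier [h_i]; in characteristic 0 all vanish in
    turn. *)
Lemma logder_mod_inj (F : numFieldType) M (f1 f2 g : {poly F}) : g`_0 = 0 ->
  f1`_0 = f2`_0 -> logder_mod M f1 g -> logder_mod M f2 g ->
  forall k, (k < M)%N -> f1`_k = f2`_k.
Proof.
move=> g0 f0 h1 h2 k; pose h := f1 - f2.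
suff: (k < M)%N -> h`_k = 0.
  by move=> hk /hk /eqP; rewrite coefB subr_eq0 => /eqP.
have /dvdXnP hh : 'X^M %| 'X * h^`() + h * g.
  have -> : 'X * h^`() + h * g
    = ('X * f1^`() + f1 * g) - ('X * f2^`() + f2 * g).
    by rewrite /h derivB; ring.
  exact: dvdp_sub.
elim/ltn_ind: k => [[|k]] IHk kM; first by rewrite coefB f0 subrr.
have := hh _ kM; rewrite coefD coefXM /= coef_deriv coefM big1 => [|i _].
  by rewrite addr0 => /eqP; rewrite mulrn_eq0 /= => /eqP.
have := ltn_ord i; rewrite ltnS leq_eqVlt => /predU1P[->|ik].
  by rewrite subnn g0 mulr0.
by rewrite IHk ?mul0r // (ltn_trans ik).
Qed.

(** * Logarithmic derivatives of [det (1 - X W)] and of truncated Euler products *)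

Section CharPolyRec.
Variable F : fieldType.

Definition det1X n (W : 'M[F]_n) : {poly F} :=
  \det (1%:M - 'X *: map_mx polyC W).

Lemma det1X0 n (W : 'M[F]_n) : (det1X W)`_0 = 1.
Proof.
rewrite -horner_coef0 /det1X -[_.[0]]/(horner_eval 0 _) -det_map_mx.
rewrite (_ : map_mx _ _ = 1%:M) ?det1 //.
apply/matrixP => i j; rewrite !mxE /= /horner_eval !hornerE subr0.
by rewrite hornerMn hornerC.
Qed.

(** Jacobi's formula gives [X (det M)' = - tr (adj M V)], and multiplying the finite geometric sum
    of [V] by [det M = adj M * M] leaves the same trace up to a term in [V ^ N.+1]. The factor
    [0 < m] removes the trace of the identity. *)
Lemma det1X_logder n (W : 'M[F]_n) N :
  logder_mod N.+1 (det1X W) (\poly_(m < N.+1) (\tr (W ^+ m) *+ (0 < m)%N)).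
Proof.
set V := 'X *: map_mx polyC W; set M := 1%:M - V.
have VE m : V ^+ m = 'X^m *: map_mx polyC (W ^+ m).
  elim: m => [|m IHm].
    by rewrite !expr0 scale1r; apply/matrixP => i j; rewrite !mxE rmorphMn.
  rewrite [LHS]exprS IHm [W ^+ m.+1]exprS map_mxM /V exprS.
  by rewrite -[_ * _]/(_ *m _) -scalemxAl -scalemxAr scalerA.
have trV m : \tr (V ^+ m) = (\tr (W ^+ m))%:P * 'X^m.
  by rewrite VE mxtraceZ trace_map_mx mulrC.
have dD : 'X * (\det M)^`() = - \tr (\adj M *m V).
  rewrite deriv_det mxtrace_mulC.
  have -> : map_mx (@deriv F) M = - map_mx polyC W.
    apply/matrixP => i j; rewrite !mxE derivB derivMn derivC mul0rn sub0r.
    by rewrite derivM derivX derivC mulr0 addr0 mul1r.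
  by rewrite mulmxN linearN /= mulrN -mxtraceZ scalemxAr.
have geo : \det M *: (\sum_(m < N) V ^+ m.+1) = \adj M *m (V - V ^+ N.+1).
  transitivity (\adj M *m (M *m \sum_(m < N) V ^+ m.+1)).
    by rewrite mulmxA mul_adj_mx mul_scalar_mx.
  congr (_ *m _); rewrite /M; elim: N => [|k IHk].
    by rewrite big_ord0 mulmx0 expr1 subrr.
  rewrite big_ord_recr /= mulmxDr IHk mulmxBl mul1mx.
  by rewrite -[V *m _]/(V * _) -exprS addrA addrNK.
(* The cofactor of [X ^ N.+1] is what the last term of the telescoped geometric sum leaves. *)
apply/dvdpP; exists (- \tr (\adj M *m map_mx polyC (W ^+ N.+1))).
rewrite dD.
have -> : \poly_(m < N.+1) (\tr (W ^+ m) *+ (0 < m)%N)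
    = \tr (\sum_(m < N) V ^+ m.+1).
  rewrite poly_def big_ord_recl /= mulr0n scale0r add0r raddf_sum /=.
  by apply: eq_bigr => m _; rewrite trV mul_polyC.
rewrite -[det1X W]/(\det M) -mxtraceZ geo mulmxBr linearB /= addrA addNr add0r.
by rewrite VE -scalemxAr mxtraceZ mulrC mulNr.
Qed.

Definition eulerX (c : nat -> nat) N : {poly F} :=
  \prod_(1 <= n < N.+1) (1 - 'X^n) ^+ c n.

Lemma eulerX_logder (c : nat -> nat) N :
  logder_mod N.+1 (eulerX c N)
    (\poly_(m < N.+1)
      ((\sum_(1 <= n < N.+1 | n %| m) n * c n)%N%:R *+ (0 < m)%N)).
Proof.
(* [G n] is the truncation of [X^n / (1 - X^n) = X^n + X^(2n) + ...], and [1 - X^n] has logarithmic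
   derivative [- n G n]. *)
pose G n : {poly F} := \poly_(m < N.+1) ((n %| m)%N && (0 < m)%N)%:R.
have -> : \poly_(m < N.+1)
      ((\sum_(1 <= n < N.+1 | n %| m) n * c n)%N%:R *+ (0 < m)%N)
    = \sum_(1 <= n < N.+1) G n *+ n *+ c n.
  apply/polyP => m; rewrite coef_sum coef_poly.
  transitivity (\sum_(1 <= n < N.+1) (G n)`_m *+ (n * c n)%N); last first.
    by apply: eq_bigr => n _; rewrite -mulrnA coefMn.
  case: ltnP => mN; last first.
    by rewrite big1 // => n _; rewrite coef_poly ltnNge mN mul0rn.
  rewrite natr_sum big_mkcond -sumrMnl; apply: eq_bigr => n _.
  rewrite coef_poly mN; case: (n %| m)%N; rewrite ?mul0rn //=.
  by case: m {mN} => [|m]; rewrite ?mul0rn.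
rewrite /eulerX [X in logder_mod _ X]big_seq [X in logder_mod _ _ X]big_seq.
rewrite -big_filter -[X in logder_mod _ _ X]big_filter.
set r := [seq _ <- _ | _].
have rP n : n \in r -> (0 < n)%N.
  by rewrite mem_filter mem_index_iota => /and3P[/andP[]].
clearbody r; elim: r rP => [|n r IHr] rP.
  by rewrite !big_nil logder_mod1.
rewrite !big_cons; apply: logder_modM; last first.
  by apply: IHr => k kr; rewrite rP // inE kr orbT.
have {IHr rP} n0 : (0 < n)%N by rewrite rP ?mem_head.
apply: logder_modX; case: n n0 => // n _; rewrite /logder_mod.
have -> : 'X * (1 - 'X^(n.+1) : {poly F})^`()
     + (1 - 'X^(n.+1)) * (G n.+1 *+ n.+1)
   = ((1 - 'X^(n.+1)) * G n.+1 - 'X^(n.+1)) *+ n.+1.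
  rewrite derivB derivC derivXn sub0r mulrN !mulrnAr -exprS.
  by rewrite mulrnBl addrC.
rewrite -mulr_natr dvdp_mulr //; apply/dvdXnP => k kN.
(* This checks [(1 - X^n) G n = X^n] up to degree [N]: beyond degree [n], the coefficients of [G n]
   at [k] and [k - n] cancel. *)
rewrite coefB mulrBl mul1r coefB coefXnM !coef_poly coefXn kN.
rewrite (leq_ltn_trans (leq_subr _ _) kN).
case: (ltnP k n.+1) => kn.
  rewrite subr0 (ltn_eqF kn) subr0; case: k {kN} kn => [|k] kn.
    by rewrite andbF.
  by rewrite andbT gtnNdvd.
case: eqVneq => [->|nk]; first by rewrite dvdnn subnn andbF subr0 subrr.
have ltnk : (n.+1 < k)%N by rewrite ltn_neqAle eq_sym nk.
by rewrite dvdn_subl // subn_gt0 ltnk (leq_trans _ kn) // subrr subr0.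
Qed.

End CharPolyRec.

(** * Matrices indexed by finite types *)

Lemma big_tuple_cons (V : nmodType) (L : finType) m (F : m.+1.-tuple L -> V) :
  \sum_t F t = \sum_a \sum_(t : m.-tuple L) F [tuple of a :: t].
Proof.
rewrite pair_big /=.
rewrite (reindex (fun p : L * m.-tuple L => [tuple of p.1 :: p.2])) //=.
exists (fun t => (thead t, [tuple of behead t])) => [[a t]|t] _ /=.
  by congr (_, _); apply: val_inj.
by rewrite -tuple_eta.
Qed.

Section FinMatrix.
Variable R : comNzRingType.

Definition fmx (I J : finType) (f : I -> J -> R) : 'M[R]_(#|I|, #|J|) :=
  \matrix_(i, j) f (enum_val i) (enum_val j).

Lemma mulfmx (I J K : finType) (f : I -> J -> R) (g : J -> K -> R) :
  fmx f *m fmx g = fmx (fun i k => \sum_j f i j * g j k).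
Proof.
apply/matrixP => i k; rewrite !mxE [RHS]big_enum_val /=.
by apply: eq_bigr => j _; rewrite !mxE.
Qed.

Lemma eq_fmx (I J : finType) (f g : I -> J -> R) : f =2 g -> fmx f = fmx g.
Proof. by move=> fg; apply/matrixP => i j; rewrite !mxE. Qed.

Lemma fmx1 (I : finType) : fmx (fun i j : I => (i == j)%:R) = 1%:M.
Proof. by apply/matrixP => i j; rewrite !mxE (inj_eq enum_val_inj). Qed.

Lemma tr_fmx (I : finType) (f : I -> I -> R) : \tr (fmx f) = \sum_i f i i.
Proof. by rewrite [RHS]big_enum_val; apply: eq_bigr => i _; rewrite mxE. Qed.

Definition rel_mx (L : finType) (e : rel L) := fmx (fun a b => (e a b)%:R).

Lemma rel_mxX (L : finType) (e : rel L) m : rel_mx e ^+ m.+1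
  = fmx (fun a b => \sum_(t : m.-tuple L) (path e a (rcons t b))%:R).
Proof.
elim: m => [|m IHm].
  rewrite expr1; apply: eq_fmx => a b.
  rewrite (big_pred1 [tuple]) /= ?andbT // => t.
  by apply/esym/eqP; exact: tuple0.
rewrite exprS IHm [LHS]mulfmx; apply: eq_fmx => a b.
rewrite big_tuple_cons; apply: eq_bigr => c _; rewrite mulr_sumr.
by apply: eq_bigr => t _; rewrite /= -mulnb natrM.
Qed.

(** The diagonal entry at [a] counts the closed words starting with [a]. For [m = 0] the trace would
    be [#|L|], against a single empty word. *)
Lemma tr_rel_mxX (L : finType) (e : rel L) m : (0 < m)%N ->
  \tr (rel_mx e ^+ m) = #|[set t : m.-tuple L | path.cycle e t]|%:R.
Proof.
case: m => // m _; rewrite rel_mxX tr_fmx -sum1dep_card natr_sum.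
rewrite [RHS]big_mkcond [RHS]big_tuple_cons.
apply: eq_bigr => a _; apply: eq_bigr => t _ /=.
by case: path.
Qed.

(** Sylvester's identity: the two block matrices, multiplied in either order, have the same
    determinant, and both products are block triangular. *)
Lemma det_1subM_comm m n (A : 'M[R]_(m, n)) (B : 'M[R]_(n, m)) :
  \det (1%:M - A *m B) = \det (1%:M - B *m A).
Proof.
have h1 : block_mx 1%:M A B 1%:M *m block_mx 1%:M 0 (- B) 1%:M
    = block_mx (1%:M - A *m B) A 0 1%:M.
  rewrite mulmx_block !mul1mx !mulmx1 !mulmx0 mulmxN add0r subrr.
  by rewrite !add0r.
have h2 : block_mx 1%:M 0 (- B) 1%:M *m block_mx 1%:M A B 1%:M
    = block_mx 1%:M A 0 (1%:M - B *m A).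
  rewrite mulmx_block !mul1mx !mul0mx !mulmx1 !addr0 mulNmx addNr.
  by rewrite addrC.
have := congr1 (@determinant _ _) h1; have := congr1 (@determinant _ _) h2.
rewrite !det_mulmx !det_ublock !det_lblock !det1 !mul1r !mulr1.
by move=> <- ->.
Qed.

End FinMatrix.

(** * Divisibility of [det (1 - X W)] by its restriction to an invariant subspace *)

Section Det1X.
Variable F : fieldType.
Lemma det1X_mulC m n (A : 'M[F]_(m, n)) (B : 'M[F]_(n, m)) :
  det1X (A *m B) = det1X (B *m A).
Proof. by rewrite /det1X !map_mxM scalemxAl det_1subM_comm -scalemxAr. Qed.

(* With the idempotent [e = J K], [1 - X A = (1 - X A (1 - e)) (1 - X A e)], as
   [(1 - e) A e = 0]. *)
Lemma det1X_dvd m n (A : 'M[F]_m) (B : 'M[F]_n) J K :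
  K *m J = 1%:M -> A *m J = J *m B -> det1X B %| det1X A.
Proof.
move=> KJ AJ; pose e := J *m K.
have -> : det1X B = det1X (A *m e).
  by rewrite mulmxA AJ -mulmxA det1X_mulC -mulmxA KJ mulmx1.
have -> : det1X A = det1X (A *m (1%:M - e)) * det1X (A *m e).
  have e0 : A *m (1%:M - e) *m (A *m e) = 0.
    (* The image of [A e] lies in the image of [J], which [1 - e] kills because [K J = 1]. *)
    have AE : A *m e = J *m B *m K by rewrite mulmxA AJ.
    rewrite -mulmxA AE mulmxBl mul1mx /e -!mulmxA (mulmxA K J) KJ.
    by rewrite mul1mx subrr mulmx0.
  have {1}-> : A = A *m (1%:M - e) + A *m e.
    by rewrite -mulmxDr subrK mulmx1.
  rewrite -det_mulmx; congr (\det _); move: e0; set U := _ *m (_ - _) => e0.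
  rewrite mulmxBl mul1mx mulmxBr mulmx1 -scalemxAl -scalemxAr -map_mxM e0.
  by rewrite map_mx0 !scaler0 subr0 map_mxD scalerDr opprD addrA addrAC.
exact: dvdp_mull.
Qed.
End Det1X.

(** * Convergence of the Euler product *)

Section Majorant.
Variable F : numFieldType.
Implicit Types f g : {poly F}.

Definition abs_poly f : {poly F} := \poly_(k < size f) `|f`_k|.

Lemma coef_abs_poly f k : (abs_poly f)`_k = `|f`_k|.
Proof.
by rewrite coef_poly; case: ltnP => // ?; rewrite nth_default ?normr0.
Qed.

Lemma le_horner f g (x : F) : 0 <= x -> (forall k, f`_k <= g`_k) ->
  f.[x] <= g.[x].
Proof.
move=> x0 fg; rewrite !(@horner_coef_wide _ (maxn (size f) (size g))) ?leq_maxl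
  ?leq_maxr //.
by apply: ler_sum => k _; rewrite ler_wpM2r ?exprn_ge0.
Qed.

Lemma abs_poly_ge0 f (x : F) : 0 <= x -> 0 <= (abs_poly f).[x].
Proof.
move=> x0; rewrite -(horner0 x); apply: le_horner => // k.
by rewrite coef0 coef_abs_poly.
Qed.

Lemma norm_horner_le f (u x : F) : `|u| <= x -> `|f.[u]| <= (abs_poly f).[x].
Proof.
move=> ux; rewrite horner_coef (le_trans (ler_norm_sum _ _ _)) //.
rewrite (@horner_coef_wide _ (size f)) ?size_poly //.
apply: ler_sum => k _; rewrite normrM coef_abs_poly ler_wpM2l // normrX.
by rewrite lerXn2r ?nnegrE // (le_trans _ ux).
Qed.

Lemma abs_polyM f g (x : F) : 0 <= x ->
  (abs_poly (f * g)).[x] <= (abs_poly f).[x] * (abs_poly g).[x].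
Proof.
move=> x0; rewrite -hornerM; apply: le_horner => // k.
rewrite coef_abs_poly !coefM (le_trans (ler_norm_sum _ _ _)) //.
by apply: ler_sum => i _; rewrite normrM !coef_abs_poly.
Qed.

Lemma abs_poly1 : abs_poly 1 = 1.
Proof.
apply/polyP => k; rewrite coef_abs_poly coef1.
by case: eqP; rewrite ?normr1 ?normr0.
Qed.

Lemma abs_poly_factor n (x : F) : (0 < n)%N ->
  (abs_poly (1 - 'X^n)).[x] = 1 + x ^+ n.
Proof.
move=> n0; rewrite (_ : abs_poly _ = 1 + 'X^n) ?hornerE ?hornerXn //.
apply/polyP => k; rewrite coef_abs_poly coefB coefD coef1 coefXn.
case: k => [|k]; first by rewrite (ltn_eqF n0) subr0 addr0 normr1.
by rewrite sub0r add0r normrN; case: eqP; rewrite ?normr1 ?normr0.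
Qed.

Lemma abs_poly_factorX n c (x : F) : (0 < n)%N -> 0 <= x ->
  (abs_poly ((1 - 'X^n) ^+ c)).[x] <= (1 + x ^+ n) ^+ c.
Proof.
move=> n0 x0; elim: c => [|c IHc].
  by rewrite !expr0 abs_poly1 hornerC.
rewrite !exprS (le_trans (abs_polyM _ _ x0)) // abs_poly_factor //.
by rewrite ler_wpM2l ?addr_ge0 ?exprn_ge0.
Qed.

(** Each factor [1 + y] is absorbed by subtracting another [y], the loss being [y (y + z + s) >= 0].
    The parameter [s] carries the amount already subtracted, so that the bound chains over
    successive Euler factors. *)
Lemma bernoulli_inv (y : F) c s : 0 <= y -> 0 <= s ->
  (1 + y) ^+ c * (1 - (y *+ c + s)) <= 1 - s.
Proof.
move=> y0 s0; elim: c s s0 => [|c IHc] s s0.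
  by rewrite expr0 mul1r mulr0n add0r.
rewrite exprSr -mulrA; apply: le_trans (IHc s s0).
rewrite ler_wpM2l ?exprn_ge0 ?addr_ge0 // mulrS -subr_ge0.
set z := y *+ c; have z0 : 0 <= z by rewrite mulrn_wge0.
have -> : 1 - (z + s) - (1 + y) * (1 - (y + z + s)) = y * (y + z + s) by ring.
by rewrite mulr_ge0 ?addr_ge0.
Qed.

(* With the factor 3, the terms [c n x ^ n] are at most [3 ^- n], so that they sum
   to at most 1/2. *)
Lemma abs_eulerX_le (c : nat -> nat) q N : (0 < q)%N ->
  (forall n, (c n <= q ^ n)%N) ->
  (abs_poly (eulerX F c N)).[(3 * q)%N%:R^-1] <= 2.
Proof.
move=> q0 cq; set x := _^-1.
have x0 : 0 <= x by rewrite invr_ge0.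
have xq n : x ^+ n *+ c n <= 3^-1 ^+ n.
  rewrite (le_trans (_ : _ <= x ^+ n *+ (q ^ n))) ?ler_wpMn2l ?exprn_ge0 //.
  by rewrite -mulr_natr natrX -exprMn /x natrM invfM mulfVK // pnatr_eq0 -lt0n.
(* This is the geometric sum of [3 ^- j] for [1 <= j <= M]. *)
pose s M : F := 2^-1 * (1 - 3^-1 ^+ M).
have sS M : s M.+1 = s M + 3^-1 ^+ M.+1 by rewrite /s exprS; field.
have s0 M : 0 <= s M.
  rewrite mulr_ge0 ?invr_ge0 // subr_ge0.
  by rewrite exprn_ile1 ?invr_ge0 // invf_le1 ?ler1n.
(* A bound by 2 alone does not pass through the induction; this one does, and it suffices as
   [1 - s N >= 1/2]. *)
suff h : (abs_poly (eulerX F c N)).[x] * (1 - s N) <= 1.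
  have : (abs_poly (eulerX F c N)).[x] * 2^-1 <= 1.
    apply: le_trans h; rewrite ler_wpM2l ?abs_poly_ge0 //.
    rewrite lerBrDl /s mulrBr mulr1.
    have : 0 <= 2^-1 * 3^-1 ^+ N :> F by rewrite mulr_ge0 ?exprn_ge0 ?invr_ge0.
    set z := 2^-1 * _ => z0.
    rewrite addrAC -mulr2n -[_^-1 *+ 2]mulr_natr mulVf ?pnatr_eq0 //.
    by rewrite lerBlDr lerDl.
  by rewrite ler_pdivrMr ?mul1r.
elim: N => [|N IHN].
  by rewrite /eulerX big_geq // abs_poly1 hornerC /s subrr mulr0 subr0 mulr1.
rewrite /eulerX big_nat_recr //= -/(eulerX F c N).
set y := x ^+ N.+1.
have y0 : 0 <= y by rewrite exprn_ge0.
apply: le_trans IHN; rewrite sS.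
have sN : 0 <= 1 - s N.+1.
  rewrite subr_ge0 (le_trans (_ : _ <= 2^-1)) ?invf_le1 ?ler1n //.
  by rewrite /s ger_pMr ?invr_gt0 // gerBl exprn_ge0 ?invr_ge0.
rewrite sS in sN.
apply: (@le_trans _ _ ((abs_poly (eulerX F c N)).[x] * ((1 + y) ^+ c N.+1
    * (1 - (y *+ c N.+1 + s N))))); last first.
  by rewrite ler_wpM2l ?abs_poly_ge0 // bernoulli_inv.
rewrite mulrA; apply: ler_pM => //.
- exact: abs_poly_ge0.
- apply: le_trans (abs_polyM _ _ x0) _.
  by rewrite ler_wpM2l ?abs_poly_ge0 // abs_poly_factorX.
- by rewrite lerB // [leLHS]addrC lerD2l xq.
Qed.

(* Beyond degree [N], [|u| <= x / 3] gains a factor [3 ^- N] over the value of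
   the majorant at [x]. *)
Lemma norm_horner_tail f g (u x : F) N : 0 <= x -> `|u| <= x / 3 ->
  (forall k, (k < N)%N -> f`_k = 0) -> (forall k, `|f`_k| <= `|g`_k|) ->
  `|f.[u]| <= 3 ^- N * (abs_poly g).[x].
Proof.
move=> x0 ux f0 fg; apply: le_trans (norm_horner_le f ux) _.
rewrite -hornerZ !(@horner_coef_wide _ (maxn (size (abs_poly f))
  (size (3 ^- N *: abs_poly g)))) ?leq_maxl ?leq_maxr //.
apply: ler_sum => k _; rewrite coefZ !coef_abs_poly.
have [kN|Nk] := ltnP k N.
  by rewrite f0 // normr0 mul0r !mulr_ge0 ?invr_ge0 ?exprn_ge0.
rewrite expr_div_n mulrA [leLHS]mulrC -[leRHS]mulrA.
apply: ler_pM; rewrite ?invr_ge0 ?mulr_ge0 ?exprn_ge0 //.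
  by rewrite lef_pV2 ?posrE ?exprn_gt0 // ler_weXn2l // ler1n.
by apply: ler_wpM2r; rewrite ?exprn_ge0.
Qed.

End Majorant.

(** * The zeta function as the reciprocal of a determinant *)

Section Zeta.
Variables (R : realType) (S : path_system).
Local Notation C := (Cplx R).
Local Notation c := (fun n => #|primes_of_length S n|).
Local Notation D := (det1X (rel_mx C (@step S))).

Lemma eulerX_det N k : (k <= N)%N -> (eulerX C c N)`_k = D`_k.
Proof.
move=> kN; have := eulerX_logder C c N.
have := det1X_logder (rel_mx C (@step S)) N.
have -> : \poly_(m < N.+1) (\tr (rel_mx C (@step S) ^+ m) *+ (0 < m)%N)
    = \poly_(m < N.+1)
      ((\sum_(1 <= n < N.+1 | n %| m) n * c n)%N%:R *+ (0 < m)%N).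
  apply/polyP => m; rewrite !coef_poly; case: ltnP => //; rewrite ltnS => mN.
  case: posnP => [->|m0]; first by rewrite !mulr0n.
  rewrite tr_rel_mxX // (@card_cycle_words _ _ m N) ?m0 //; congr (_%:R *+ _).
  rewrite big_nat_cond [RHS]big_nat_cond.
  apply: eq_bigr => n /andP[/andP[n0 _] _].
  by rewrite card_prime_words.
set g := \poly_(m < N.+1) _ => hD hE.
apply: (logder_mod_inj (g := g) _ _ hE hD); rewrite ?ltnS //.
  by rewrite coef_poly mulr0n.
rewrite det1X0 -horner_coef0 horner_prod big_nat_cond big1 // => n.
case/andP=> /andP[n0 _] _; rewrite !hornerE expr0n (gtn_eqF n0) subr0.
by rewrite expr1n.
Qed.

Lemma card_primes_le n : (c n <= #|letter S|.+1 ^ n)%N.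
Proof.
apply: leq_trans (leq_imset_card _ _) _; apply: leq_trans (max_card _) _.
by rewrite card_tuple; case: n => // n; rewrite leq_exp2r.
Qed.

Lemma euler_productE (u : C) N :
  euler_product S u N = (eulerX C c N).[u]^-1.
Proof.
rewrite /eulerX horner_prod -prodfV; apply: eq_bigr => n _.
by rewrite prodr_const exprVn !hornerE.
Qed.

Lemma Cplx_expVn_lt (e : C) : 0 < e ->
  exists M, forall N, (M <= N)%N -> 3 ^- N <= e.
Proof.
move=> e0; have := e0; rewrite ltcE /= => /andP[/eqP ei er].
exists (Num.bound (complex.Re e)^-1) => N MN.
have -> : (3 ^- N : C) = (3 ^- N : R)%:C%C.
  by rewrite fmorphV rmorphXn rmorph_nat.
have -> : e = (complex.Re e)%:C%C by case: (e) ei => a b /= ->.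
rewrite lecR ltW //.
apply: le_lt_trans (realalg.RealAlg.upper_nthrootVP er MN).
by rewrite lef_pV2 ?posrE ?exprn_gt0 // lerXn2r ?nnegrE ?ler_nat.
Qed.

(** Coefficientwise stabilization becomes convergence near 0 because the truncated products have
    majorants bounded by 2 at a common point [x]. *)
Lemma zeta_reciprocal_coef (d : {poly C}) :
  (forall N k, (k <= N)%N -> (eulerX C c N)`_k = d`_k) -> zeta_reciprocal S d.
Proof.
move=> Ed.
have d0 : d`_0 = 1 by rewrite -(Ed 0%N) // /eulerX big_geq // coef1.
(* There are at most [q ^ n] primes of length [n]; the successor keeps [q] positive even without
   letters. *)
pose q := #|letter S|.+1; pose x : C := (3 * q)%N%:R^-1.
have x0 : 0 < x by rewrite invr_gt0 ltr0n muln_gt0.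
have Ex N : (abs_poly (eulerX C c N)).[x] <= 2.
  by apply: abs_eulerX_le => //; exact: card_primes_le.
suff main (u : C) : `|u| <= x / 3 ->
    [/\ cvgn (euler_product S u), d.[u] != 0 & zeta S u = d.[u]^-1].
  apply/nbhs_ballP; exists (x / 3); first exact: divr_gt0.
  move=> u; rewrite -ball_normE => ux; apply: main; apply: ltW.
  by rewrite -normrN -[- u]sub0r.
move=> ux.
(* The difference vanishes up to degree [N], and beyond it [d] has no coefficients left, so the
   Euler product majorizes it. *)
have tail N : (size d <= N)%N -> `|(eulerX C c N).[u] - d.[u]| <= 3 ^- N.
  move=> DN; rewrite -hornerN -hornerD.
  apply: (@le_trans _ _ (3 ^- N.+1 * (abs_poly (eulerX C c N)).[x])).
    apply: norm_horner_tail => // [|k|k]; first exact: ltW.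
      by rewrite ltnS coefD coefN => kN; rewrite Ed ?subrr.
    rewrite coefD coefN.
    have [kN|Nk] := leqP k N; first by rewrite Ed // subrr normr0.
    have -> : d`_k = 0 by apply/nth_default/(leq_trans DN)/ltnW.
    by rewrite subr0.
  apply: (@le_trans _ _ (3 ^- N.+1 * 3)).
    by rewrite ler_wpM2l ?invr_ge0 ?exprn_ge0 // (le_trans (Ex N)) ?ler_nat.
  by rewrite exprSr invfM -mulrA mulVf ?mulr1 ?pnatr_eq0.
(* [d - 1] has no constant term, so its value at [u] has norm at most [2 / 3]. *)
have D0 : d.[u] != 0.
  have : `|(d - 1).[u]| <= 3 ^- 1 * (abs_poly (eulerX C c (size d))).[x].
    apply: norm_horner_tail => // [|k|k]; first exact: ltW.
      by case: k => // _; rewrite coefB coef1 d0 subrr.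
    rewrite coefB coef1; case: k => [|k]; first by rewrite d0 subrr normr0.
    rewrite subr0; have [kN|Nk] := leqP k.+1 (size d); first by rewrite Ed.
    have -> : d`_k.+1 = 0 by apply/nth_default/ltnW.
    by rewrite normr0.
  apply: contraTneq => uD; rewrite !hornerE uD sub0r normrN normr1.
  apply/negP => /le_trans /(_ (_ : _ <= 3 ^- 1 * 2)).
  rewrite ler_wpM2l ?invr_ge0 // => /(_ isT).
  by rewrite expr1 ler_pdivlMl ?ltr0n // mulr1 ler_nat.
have Ecvg : ((eulerX C c N).[u] @[N --> \oo] --> d.[u])%classic.
  apply/cvgrPdist_le => e e0; have [M hM] := Cplx_expVn_lt e0.
  exists (maxn M (size d)) => // N /=; rewrite geq_max => /andP[MN DN].
  by rewrite distrC (le_trans (tail N DN)) ?hM.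
have Pcvg : (euler_product S u @ \oo --> d.[u]^-1)%classic.
  have -> : euler_product S u = (fun N => (eulerX C c N).[u]^-1).
    by apply/funext => N; exact: euler_productE.
  exact: cvgV.
split; [exact: cvgP Pcvg|exact: D0|].
by apply: cvg_lim Pcvg; exact: norm_hausdorff.
Qed.

Lemma zeta_reciprocal_det : zeta_reciprocal S D.
Proof. exact/zeta_reciprocal_coef/eulerX_det. Qed.

End Zeta.

(** * The quotient by an edge-free action *)

Lemma sum_tagged (I : finType) (J : I -> finType) (F : forall i, J i -> nat) k :
  (\sum_(t : {i & J i}) F (tag t) (tagged t) * (tag t == k)
    = \sum_(g : J k) F k g)%N.
Proof.
rewrite -(sig_big_dep xpredT (fun _ => xpredT) (fun i g => F i g * (i == k))%N).
rewrite (bigD1 k) //= [X in (_ + X)%N]big1 ?addn0 => [|i /negPf ik].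
  by apply: eq_bigr => g _; rewrite eqxx muln1.
by rewrite big1 // => g _; rewrite ik muln0.
Qed.

Section OrbitProj.
Variables (gT : finGroupType) (T : finType) (to : {action gT &-> T}).

Lemma orbit_projP x y :
  reflect (exists a, to x a = y) (orbit_proj to x == orbit_proj to y).
Proof.
apply: (iffP eqP) => [[xy]|[a <-]].
  have : y \in orbit to [set: gT] x by rewrite xy orbit_refl.
  by case/orbitP => a _; exists a.
by apply: val_inj; rewrite /= orbit_act ?inE.
Qed.

Lemma orbit_proj_surj O : exists x, orbit_proj to x == O.
Proof.
case: O => O OP; have /imsetP[x _ OE] := OP; exists x; apply/eqP/val_inj.
by rewrite /= OE.
Qed.

Definition orbit_repr O : T := xchoose (orbit_proj_surj O).

Lemma orbit_reprK : cancel orbit_repr (orbit_proj to).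
Proof. by move=> O; apply/eqP; exact: (xchooseP (orbit_proj_surj O)). Qed.

Lemma card_astab1_orbit x y : orbit_proj to x = orbit_proj to y ->
  #|'C[x | to]%g| = #|'C[y | to]%g|.
Proof.
move/eqP/orbit_projP => [a <-].
by rewrite astab1_act cardJg.
Qed.
End OrbitProj.

(** * Reduced steps in [Y] compared with those in the quotient graph of groups *)

Section Quotient.
Variables (gT : finGroupType) (Y : graph) (A : graph_action gT Y).
Hypothesis freeA : edge_free A.
Variable (TX : {set half_edge (quotient_graph A)}) (T : tree_lift TX).
Local Notation X := (quotient_graph A).
Local Notation projH := (orbit_proj (actH A)).
Local Notation projV := (orbit_proj (actV A)).

Lemma rootv_proj (h : half_edge Y) :
  rootv (projH h : half_edge X) = projV (rootv h).
Proof. exact: quotient_mapE. Qed.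

Lemma bar_proj (h : half_edge Y) : bar (projH h : half_edge X) = projH (bar h).
Proof. exact: quotient_mapE. Qed.

(** Some lift [h0] of [k] is rooted at [v]. All lifts are its translates, distinct by edge-freeness,
    and a translate by [a] is rooted at [v] exactly when [a] fixes [v]. *)
Lemma card_star_fiber (v : vertex Y) (k : half_edge X) : rootv k = projV v ->
  #|[set h : half_edge Y | (rootv h == v) && (projH h == k)]|
    = #|'C[v | actV A]%g|.
Proof.
move=> rk.
have [h0 h0v h0k] : exists2 h0 : half_edge Y, rootv h0 = v & projH h0 = k.
  have [h /eqP hk] := orbit_proj_surj k.
  have : projV (rootv h) == projV v by rewrite -rootv_proj hk rk.
  case/orbit_projP => a hav; exists (actH A h a); first by rewrite act_rootv.
  by rewrite -hk; apply/eqP; rewrite eq_sym; apply/orbit_projP; exists a.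
have inj : injective (actH A h0).
  move=> a b hab; apply/eqP; rewrite eq_mulgV1; apply/eqP.
  by apply: (freeA (h := h0)); rewrite actM hab actK.
rewrite -(card_imset _ inj); apply: eq_card => h; rewrite inE.
apply/andP/imsetP => [[/eqP hv /eqP hk]|[a /astab1P av ->]].
  have : projH h0 == projH h by rewrite h0k hk.
  case/orbit_projP => a ha; exists a => //; apply/astab1P.
  by rewrite -h0v -act_rootv ha hv h0v.
split; first by rewrite act_rootv h0v av.
by rewrite -h0k eq_sym; apply/orbit_projP; exists a.
Qed.

Local Notation gog := (quotient_gog T).
Local Notation LX := (letter (gog_paths gog)).

Definition quotient_step (h : half_edge X) (t : LX) : bool :=
  (rootv (tag t) == rootv (bar h))
    && ~~ ((tag t == bar h) && (tagged t == 1%g)).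

(** When the roots match, both sides are the order of the stabilizer of [u], less one if [k] is the
    reversal of the image of [h]: in [Y] the lift [bar h] is excluded, in the quotient the letter
    with trivial group element. *)
Lemma card_quotient_step (h : half_edge Y) (k : half_edge X) :
  #|[set k' | @step (graph_paths Y) h k' && (projH k' == k)]|
   = (\sum_(t : LX) quotient_step (projH h) t * (tag t == k))%N.
Proof.
pose K := rootv k == rootv (bar (projH h : half_edge X)).
pose B := k == bar (projH h : half_edge X).
transitivity (\sum_(g : vgroup (rootv (k : half_edge (base gog))))
    (K && ~~ (B && (g == 1%g))))%N; last first.
  exact/esym/(sum_tagged
    (fun (i : half_edge (base gog)) (g : vgroup (rootv i)) =>
    (rootv i == rootv (bar (projH h : half_edge X)))
      && ~~ ((i == bar (projH h : half_edge X)) && (g == 1%g)) : nat)).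
pose u := rootv (bar h).
have KE : K = (rootv k == projV u) by rewrite /K bar_proj rootv_proj.
have BE : B = (projH (bar h) == k) by rewrite /B bar_proj eq_sym.
pose S := [set k' | (rootv k' == u) && (projH k' == k)].
have -> : [set k' | @step (graph_paths Y) h k' && (projH k' == k)] = S :\ bar h.
  by apply/setP => k'; rewrite !inE /= -andbA; do !bool_congr.
have [rk|nK] := boolP K; last first.
  rewrite big1 // [S](_ : _ = finset.set0) ?finset.set0D ?cards0 //.
  apply/setP => k'; rewrite !inE; apply/negP => /andP[/eqP ku /eqP kk].
  by move: nK; rewrite KE -kk rootv_proj ku eqxx.
(* The excluded element is added back on both sides, which avoids truncated subtraction. *)
apply/eqP; rewrite -(eqn_add2l (bar h \in S)) -cardsD1 inE eqxx -BE.
move: rk; rewrite KE => /eqP rk; rewrite card_star_fiber //.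
have -> : #|'C[u | actV A]%g| = #|vgroup (rootv (k : half_edge (base gog)))|.
  rewrite /= card_sub; apply: card_astab1_orbit; rewrite -rk.
  by rewrite liftV_proj.
case: (B) => /=; last by rewrite sum_nat_const muln1.
rewrite -sum1_card (bigD1 1%g) //= eqn_add2l big_mkcond; apply/eqP.
by apply: eq_bigr => g _; case: eqP.
Qed.

Lemma det1X_quotient_dvd (F : fieldType) :
  det1X (rel_mx F (@step (gog_paths gog)))
    %| det1X (rel_mx F (@step (graph_paths Y))).
Proof.
pose Pi := fmx (fun (t : LX) (k : half_edge X) => (tag t == k)%:R : F).
pose C := fmx (fun (h : half_edge X) (t : LX) => (quotient_step h t)%:R : F).
have -> : rel_mx F (@step (gog_paths gog)) = Pi *m C.
  rewrite mulfmx; apply: eq_fmx => s t.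
  rewrite (bigD1 (tag s)) //= eqxx mul1r big1 ?addr0 // => h.
  by rewrite eq_sym => /negPf->; rewrite mul0r.
rewrite det1X_mulC.
(* The columns of [J] are the indicators of the orbits, a basis of the invariant functions; [K]
   evaluates at orbit representatives. *)
pose J := fmx (fun (h : half_edge Y) (k : half_edge X) =>
  (projH h == k)%:R : F).
pose K := fmx (fun (k : half_edge X) (h : half_edge Y) =>
  (h == orbit_repr k)%:R : F).
apply: (@det1X_dvd _ _ _ _ _ J K).
  rewrite mulfmx -fmx1; apply: eq_fmx => k l.
  rewrite (bigD1 (orbit_repr k)) //= eqxx mul1r orbit_reprK big1 ?addr0 //.
  by move=> h /negPf->; rewrite mul0r.
rewrite !mulfmx; apply: eq_fmx => h k.
rewrite [RHS](bigD1 (projH h)) //= eqxx mul1r.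
rewrite [X in _ + X]big1 ?addr0; last first.
  by move=> l; rewrite eq_sym => /negPf->; rewrite mul0r.
transitivity
  (#|[set k' | @step (graph_paths Y) h k' && (projH k' == k)]|%:R : F).
  rewrite -sum1dep_card natr_sum [RHS]big_mkcond; apply: eq_bigr => k' _.
  by rewrite -natrM mulnb; case: ifP.
rewrite card_quotient_step natr_sum; apply: eq_bigr => t _.
by rewrite natrM.
Qed.

End Quotient.

Unset Implicit Arguments.
Set Strict Implicit.

Theorem corollary4p15 (R : realType) (gT : finGroupType) (Y : graph)
    (A : graph_action gT Y) (TX : {set half_edge (quotient_graph A)})
    (T : tree_lift TX) :
  connected_graph Y -> edge_free A -> spanning_tree TX ->
  exists P Q : {poly Cplx R},
    [/\ zeta_reciprocal (gog_paths (quotient_gog T)) P,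
        zeta_reciprocal (graph_paths Y) Q
      & P %| Q].
Proof.
move=> _ freeA _.
exists (det1X (rel_mx (Cplx R) (@step (gog_paths (quotient_gog T))))).
exists (det1X (rel_mx (Cplx R) (@step (graph_paths Y)))).
split; [exact: zeta_reciprocal_det|exact: zeta_reciprocal_det|].
exact: det1X_quotient_dvd.
Qed.
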